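(* Let $x_1,x_2,x_3,x_4\in\mathbb Q$ be pairwise distinct (finite) rationals, and let $\Delta_{ij}$ be the Pl\''ucker determinants of their normalized primitive lifts. Then $$\frac{\mathrm{cr}'(x_1,x_2;x_3,x_4)}{\mathrm{cr}(x_1,x_2;x_3,x_4)}=\frac{1}{2\Delta_{34}}\left[\frac{(\Delta_{14}-\Delta_{13})^2-\Delta_{34}^2}{\Delta_{13}\Delta_{14}}-\frac{(\Delta_{24}-\Delta_{23})^2-\Delta_{34}^2}{\Delta_{23}\Delta_{24}}\right].$$
   Context: **Normalized lifts.** For $x_i=a_i/b_i$ with $a_i,b_i\in\mathbb Z$, $\gcd(a_i,b_i)=1$, $b_i>0$, the normalized primitive lift is $\binom{a_i}{b_i}$, and $\Delta_{ij}=a_ib_j-a_jb_i$. **$q$-rationals.** $[\,\cdot\,]_q:\mathbb P^1(\mathbb Q)=\mathbb Q\cup\{\infty\}\to\mathbb P^1(\mathbb Q(q))$ is the unique map with $[0]_q=0$, $[x+1]_q=q[x]_q+1$ and $[-1/x]_q=-1/(q[x]_q)$ for all $x$ (usual conventions for $\infty$; in particular $[\infty]_q=\infty$). For finite $x$, $[x]_q$ is a rational function of $q$, regular at $q=1$ with $[x]_1=x$. **Cross-ratios.** $\mathrm{cr}(x_1,x_2;x_3,x_4)=\frac{(x_1-x_3)(x_2-x_4)}{(x_1-x_4)(x_2-x_3)}$ and $\mathrm{cr}_q(x_1,x_2;x_3,x_4)=\mathrm{cr}([x_1]_q,[x_2]_q;[x_3]_q,[x_4]_q)\in\mathbb Q(q)$.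 **Taylor coefficients.** With $q=e^h$, $\mathrm{cr}_{e^h}=\mathrm{cr}+\mathrm{cr}'h+\frac{\mathrm{cr}''}{2}h^2+\cdots$ is the Taylor expansion at $h=0$; $\mathrm{cr}'$ is the first coefficient. *)

(* Defs.v *)
From HB Require Import structures.
From mathcomp Require Import all_boot all_order all_algebra.
From mathcomp Require Import generic_quotient.
From mathcomp Require Import ring lra zify.
From mathcomp Require Import all_classical all_reals all_analysis.
Import Order.TTheory GRing.Theory Num.Theory.
Import numFieldNormedType.Exports.

Set Implicit Arguments.
Unset Strict Implicit.
Unset Printing Implicit Defensive.

Local Open Scope ring_scope.
Local Open Scope quotient_scope.

Notation ratfun := {fraction {poly rat}}.

Definition qvar : ratfun := FracField.tofrac 'X.

(* [option F] is the projective line over F, [None] being the point at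
   infinity; [pneginv] is x |-> -1/x with -1/0 = oo and -1/oo = 0, and
   [paffine a b] is x |-> a x + b (for a != 0), which fixes oo. *)
Definition pneginv (F : fieldType) (x : option F) : option F :=
  match x with
  | None => Some 0
  | Some t => if t == 0 then None else Some (- t^-1)
  end.

Definition paffine (F : fieldType) (a b : F) (x : option F) : option F :=
  omap (fun t => a * t + b) x.

Definition is_qrational_map (Q : option rat -> option ratfun) : Prop :=
  [/\ Q (Some 0) = Some 0,
      forall x, Q (paffine 1 1 x) = paffine qvar 1 (Q x) &
      forall x, Q (pneginv x) = pneginv (paffine qvar 0 (Q x))].

(* [qrational_map_finite] below shows that [Q (Some x)] is never oo when Q is
   the q-rational map, so the default value 0 is never used. *)
Definition qrational (Q : option rat -> option ratfun) (x : rat) : ratfun :=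
  odflt 0 (Q (Some x)).

Definition cross_ratio (F : fieldType) (x1 x2 x3 x4 : F) : F :=
  ((x1 - x3) * (x2 - x4)) / ((x1 - x4) * (x2 - x3)).

Definition cross_ratio_q (Q : option rat -> option ratfun)
    (x1 x2 x3 x4 : rat) : ratfun :=
  cross_ratio (qrational Q x1) (qrational Q x2)
              (qrational Q x3) (qrational Q x4).

(* Representatives in {fraction _} need not be reduced, and a common factor of
   numerator and denominator could vanish at t: it is divided out first.
   The value is 0 at a pole. *)
Definition ratfun_eval (R : realType) (f : ratfun) (t : R) : R :=
  let n := (frac (repr f)).1 in
  let d := (frac (repr f)).2 in
  let g := gcdp n d in
  (map_poly ratr (n %/ g)).[t] / (map_poly ratr (d %/ g)).[t].

Definition cross_ratio_exp (R : realType) (Q : option rat -> option ratfun)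
    (x1 x2 x3 x4 : rat) (h : R) : R :=
  ratfun_eval (cross_ratio_q Q x1 x2 x3 x4) (expR h).

Definition cross_ratio' (R : realType) (Q : option rat -> option ratfun)
    (x1 x2 x3 x4 : rat) : R :=
  derive1 (@cross_ratio_exp R Q x1 x2 x3 x4) 0.

(* [numq x] and [denq x] are coprime, with [0 < denq x]. *)
Definition plucker (x y : rat) : int := numq x * denq y - numq y * denq x.

Lemma ratfun_evalE (R : realType) (n d : {poly rat}) (t : R) :
  (map_poly ratr d).[t] != 0 ->
  ratfun_eval (FracField.tofrac n / FracField.tofrac d) t =
  (map_poly ratr n).[t] / (map_poly ratr d).[t].
Proof.
move=> dt0.
have d0 : d != 0 by apply: contraNneq dt0 => ->; rewrite rmorph0 horner0.
set f := _ / _; rewrite /ratfun_eval.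
set r := repr f; set g := gcdp _ _.
have rd0 : (frac r).2 != 0 by exact: denom_ratioP.
have g0 : g != 0 by rewrite gcdp_eq0 negb_and rd0 orbT.
have fE : FracField.tofrac n / FracField.tofrac d =
          \pi_{fraction {poly rat}} (Ratio n d).
  rewrite -[LHS]/(FracField.mul _ (FracField.inv _)).
  rewrite !piE /FracField.invf /FracField.mulf /=.
  by rewrite !numden_Ratio ?oner_neq0 ?mulr1 ?mul1r.
have nd : n * (frac r).2 = d * (frac r).1.
  have := FracField.equivf_r (Ratio n d).
  by rewrite -fE -/f -/r !numden_Ratio.
have gn : (frac r).1 = (frac r).1 %/ g * g by rewrite divpK// dvdp_gcdl.
have gd : (frac r).2 = (frac r).2 %/ g * g by rewrite divpK// dvdp_gcdr.
set n' := _ %/ g in gn *; set d' := _ %/ g in gd *.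
have nd' : n * d' = d * n'.
  by apply: (mulIf g0); rewrite -!mulrA -gd -gn.
have cop : coprimep n' d'.
  by rewrite coprimep_div_gcd// rd0 orbT.
have evnd : (map_poly ratr n).[t] * (map_poly ratr d').[t] =
            (map_poly ratr d).[t] * (map_poly ratr n').[t] :> R.
  by rewrite -!hornerM -!rmorphM nd'.
have d't : (map_poly ratr d').[t] != 0 :> R.
  have /dvdpP[k dE] : d' %| d.
    by rewrite -(Gauss_dvdpl _ (_ : coprimep d' n')) 1?coprimep_sym//
               -nd' dvdp_mull.
  by apply: contraNneq dt0 => e; rewrite dE rmorphM hornerM e mulr0.
by apply/eqP; rewrite eqr_div// evnd mulrC.
Qed.

(* f is regular at 1 with f(1) = v. *)
Definition regular1 (f : ratfun) (v : rat) : Prop :=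
  exists n d : {poly rat},
    [/\ f = FracField.tofrac n / FracField.tofrac d, d.[1] != 0
      & v = n.[1] / d.[1]].

Lemma tofrac_neq0 (d : {poly rat}) : d.[1] != 0 -> FracField.tofrac d != 0.
Proof.
by move=> d1; rewrite tofrac_eq0; apply: contraNneq d1 => ->; rewrite horner0.
Qed.

Lemma regular1_poly (p : {poly rat}) : regular1 (FracField.tofrac p) p.[1].
Proof.
exists p, 1; split; rewrite ?hornerC ?oner_neq0 ?divr1//.
Qed.

Lemma regular1D f g v w :
  regular1 f v -> regular1 g w -> regular1 (f + g) (v + w).
Proof.
move=> [n [d [-> d1 ->]]] [m [e [-> e1 ->]]].
exists (n * e + m * d), (d * e); split; rewrite ?hornerD ?hornerM ?mulf_neq0//.
  by rewrite tofracD !tofracM addf_div ?tofrac_neq0.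
by rewrite addf_div.
Qed.

Lemma regular1M f g v w :
  regular1 f v -> regular1 g w -> regular1 (f * g) (v * w).
Proof.
move=> [n [d [-> d1 ->]]] [m [e [-> e1 ->]]].
exists (n * m), (d * e); split; rewrite ?hornerM ?mulf_neq0//.
  by rewrite !tofracM mulf_div.
by rewrite mulf_div.
Qed.

Lemma regular1V f v : regular1 f v -> v != 0 -> regular1 f^-1 v^-1.
Proof.
move=> [n [d [-> d1 ->]]]; rewrite mulf_eq0 invr_eq0 negb_or => /andP[n1 _].
by exists d, n; rewrite !invf_div.
Qed.

Lemma regular1_neq0 f v : regular1 f v -> v != 0 -> f != 0.
Proof.
move=> [n [d [-> d1 ->]]]; rewrite mulf_eq0 invr_eq0 negb_or => /andP[n1 _].
by rewrite mulf_neq0 ?invr_eq0 ?tofrac_neq0.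
Qed.

Lemma regular1_1 : regular1 1 1.
Proof. by have := regular1_poly 1; rewrite tofrac1 hornerC. Qed.

Lemma regular1_qvar : regular1 qvar 1.
Proof. by have := regular1_poly 'X; rewrite hornerX. Qed.

Lemma regular1N f v : regular1 f v -> regular1 (- f) (- v).
Proof.
move=> h; rewrite -mulN1r -[- v]mulN1r; apply: regular1M h.
by have := regular1_poly (-1); rewrite tofracN tofrac1 hornerN hornerC.
Qed.

Lemma qvar_neq0 : qvar != 0.
Proof. by apply: regular1_neq0 regular1_qvar _. Qed.


Definition int_mul_of (b : nat) (x : rat) : Prop := exists a : int, x * b%:R = a%:~R.

Lemma int_mul_of_denq x : int_mul_of `|denq x| x.
Proof. by exists (numq x); rewrite natr_absz normr_denq numqE. Qed.

Lemma denq_abs_gt0 x : (0 < `|denq x|)%N.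
Proof. by rewrite absz_gt0 denq_neq0. Qed.

Lemma int_mul_of_ceil b x : (0 < b)%N -> int_mul_of b x ->
  let z := (Num.ceil x)%:~R - x in
  [/\ 0 <= z, z < 1 &
   z != 0 -> exists2 p : nat, (0 < p < b)%N & int_mul_of p z^-1].
Proof.
move=> b0 [a xE] z.
have z0 : 0 <= z by rewrite subr_ge0 ceil_ge.
have z1 : z < 1 by have := ceilB1_lt x; rewrite rmorphB/= /z; lra.
split=> // zn0.
have zp : 0 < z by rewrite lt_def zn0.
pose k : int := Num.ceil x * b%:Z - a.
have zE : z * b%:R = k%:~R by rewrite mulrBl xE rmorphB rmorphM.
have bq : 0 < b%:R :> rat by rewrite ltr0n.
have k0 : 0 < k by rewrite -(ltr0z rat) -zE mulr_gt0.
have kb : k < b%:Z by rewrite -(ltr_int rat) -zE gtr_pMl.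
exists `|k|%N; first by apply/andP; split; lia.
by exists b%:Z; rewrite natr_absz gtr0_norm// -zE mulKf.
Qed.

Lemma rat_modular_ind (P : rat -> Prop) :
  P 0 -> (forall x, P x <-> P (x + 1)) -> (forall x, x != 0 -> P x -> P (- x^-1)) ->
  forall x, P x.
Proof.
move=> P0 PT PS.
have PTz (k : int) x : P x <-> P (x + k%:~R).
  elim: k x => [x|k ih x|k ih x]; first by rewrite addr0.
    by rewrite -addn1 PoszD rmorphD addrA -PT -ih.
  rewrite (PT (x + _)) ih; suff -> : x + (- k.+1%:Z)%:~R + 1 = x + (- k%:Z)%:~R by [].
  by rewrite -addn1 PoszD !rmorphN rmorphD /=; ring.
suff H n : forall b x, (0 < b <= n)%N -> int_mul_of b x -> P x.
  move=> x; apply: (H `|denq x|%N `|denq x|%N); last exact: int_mul_of_denq.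
  by rewrite leqnn denq_abs_gt0.
elim: n => [|n ih] b x /andP[b0 bn] bx; first by lia.
have [] := int_mul_of_ceil b0 bx; set z := _ - x => z0 z1 zV.
have -> : x = - z + (Num.ceil x)%:~R by rewrite /z; ring.
apply: (PTz _ (- z)).1; have [->|zn0] := eqVneq z 0; first by rewrite oppr0.
have [p pb pz] := zV zn0.
by rewrite -[z]invrK; apply: PS; rewrite ?invr_eq0//; apply: ih pz; lia.
Qed.

Lemma qrational_map_regular Q : is_qrational_map Q ->
  forall x, exists2 f, Q (Some x) = Some f & regular1 f x.
Proof.
move=> [Q0 QT QS]; apply: rat_modular_ind.
- by exists 0 => //; have := regular1_poly 0; rewrite tofrac0 horner0.
- move=> x; have := QT (Some x); rewrite /= mul1r => QTx; split.
    move=> [f Qx fx]; exists (qvar * f + 1); first by rewrite QTx Qx.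
    apply: (regular1D _ regular1_1); rewrite -[x]mul1r.
    exact: regular1M regular1_qvar fx.
  move=> [g Qx1 gx]; move: QTx; rewrite Qx1; case: (Q (Some x)) => //= f [gE].
  exists f => //; have -> : f = qvar^-1 * (g + - 1).
    by rewrite gE addrK mulKf// qvar_neq0.
  have -> : x = 1^-1 * ((x + 1) + - 1) :> rat by rewrite addrK invr1 mul1r.
  apply: regular1M; first by apply: regular1V; [exact: regular1_qvar|].
  by apply: regular1D => //; apply/regular1N/regular1_1.
- move=> x x0 [f Qx fx]; have := QS (Some x); rewrite /= (negPf x0) Qx/= addr0.
  have f0 := regular1_neq0 fx x0.
  rewrite mulf_eq0 (negPf qvar_neq0) (negPf f0)/= => ->.
  eexists; first by [].
  apply: regular1N; rewrite invfM; have -> : x^-1 = 1^-1 * x^-1 by rewrite invr1 mul1r.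
  by apply: regular1M; apply: regular1V => //; exact: regular1_qvar.
Qed.

Lemma qrational_map_finite Q x :
  is_qrational_map Q -> Q (Some x) = Some (qrational Q x).
Proof. by move=> /qrational_map_regular/(_ x)[f Qx _]; rewrite /qrational Qx. Qed.

Lemma qrational_map_oo Q : is_qrational_map Q -> Q None = None.
Proof.
move=> [Q0 _ /(_ (Some 0))]; rewrite /= Q0/= => ->.
by rewrite mulr0 addr0 eqxx.
Qed.

Lemma qrational_map_unique Q Q' :
  is_qrational_map Q -> is_qrational_map Q' -> Q =1 Q'.
Proof.
move=> HQ HQ' [x|]; last by rewrite !qrational_map_oo.
case: (HQ) (HQ') => [Q0 QT QS] [Q'0 Q'T Q'S].
elim/rat_modular_ind: x => [|x|x x0 QQ']; first by rewrite Q0 Q'0.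
- have := QT (Some x); have := Q'T (Some x); rewrite /= mul1r => -> ->.
  split=> [->//|]; case: (Q _) (Q' _) => [f|] [f'|]//= [].
  by move=> /addIr/(mulfI qvar_neq0) ->.
- have := QS (Some x); have := Q'S (Some x).
  by rewrite /= (negPf x0) QQ' => -> ->.
Qed.

(* [c - z]_q = [c]_q - q^(c-1) / [1/z]_q, with c = ceil x and z = c - x, so
   that the denominator of 1/z is smaller than that of x. *)
Definition qint (c : int) : ratfun := (qvar ^ c - 1) / (qvar - 1).

Fixpoint qfrac_rec (n : nat) (x : rat) : ratfun :=
  if n isn't n'.+1 then 0 else
  let c := Num.ceil x in
  let z := c%:~R - x in
  if z == 0 then qint c else qint c - qvar ^ (c - 1) / qfrac_rec n' z^-1.

Definition qfrac (x : rat) : ratfun := qfrac_rec `|denq x| x.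

Lemma qfrac_recE n m b x : (0 < b <= n)%N -> (b <= m)%N -> int_mul_of b x ->
  qfrac_rec n x = qfrac_rec m x.
Proof.
elim: n m b x => [|n ih] m b x /andP[b0 bn] bm bx; first by lia.
case: m bm => [|m] bm; first by lia.
have [_ _ zV] /= := int_mul_of_ceil b0 bx.
case: eqP => // /eqP/zV[p pb pz].
by rewrite (ih m p)//; lia.
Qed.

Lemma qfracE x : let c := Num.ceil x in let z := c%:~R - x in
  qfrac x = if z == 0 then qint c else qint c - qvar ^ (c - 1) / qfrac z^-1.
Proof.
move=> c z; have b0 := denq_abs_gt0 x; have bx := int_mul_of_denq x.
rewrite /qfrac (qfrac_recE (m := `|denq x|.+1) (b := `|denq x|%N))//; last by lia.
have [_ _ zV] /= := int_mul_of_ceil b0 bx; rewrite -/c -/z.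
case: eqP => // /eqP/zV[p pb pz].
rewrite (qfrac_recE (m := (p + `|denq z^-1|)) (b := p))//; try lia.
rewrite (@qfrac_recE `|denq z^-1| (p + `|denq z^-1|) `|denq z^-1|)//.
- by rewrite denq_abs_gt0 leqnn.
- by rewrite leq_addl.
- exact: int_mul_of_denq.
Qed.

Lemma qvarB1_neq0 : qvar - 1 != 0.
Proof.
rewrite -tofrac1 -tofracB tofrac_eq0.
by apply/eqP => /(congr1 (fun p : {poly rat} => p.[0])); rewrite !hornerE.
Qed.

Lemma qintS_identity (F : fieldType) (q u : F) : q - 1 != 0 ->
  (u * q - 1) / (q - 1) = q * ((u - 1) / (q - 1)) + 1.
Proof. by move=> q1; field. Qed.

Lemma qfracS_identity (F : fieldType) (q a b : F) :
  q * a + 1 - q * b = q * (a - b) + 1.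
Proof. by ring. Qed.

Lemma qintS c : qint (c + 1) = qvar * qint c + 1.
Proof.
by rewrite /qint expfzDr ?qvar_neq0// expr1z qintS_identity// qvarB1_neq0.
Qed.

Lemma qint0 : qint 0 = 0. Proof. by rewrite /qint expr0z subrr mul0r. Qed.

Lemma qfracS x : qfrac (x + 1) = qvar * qfrac x + 1.
Proof.
rewrite qfracE [qfrac x]qfracE.
have -> : Num.ceil (x + 1) = Num.ceil x + 1.
  by rewrite ceilDrz// ceil1.
have -> : (Num.ceil x + 1)%:~R - (x + 1) = (Num.ceil x)%:~R - x.
  by rewrite rmorphD/= opprD addrACA subrr addr0.
rewrite qintS; case: ifP => _ //.
rewrite -qfracS_identity; congr (_ - _).
rewrite mulrA; congr (_ / _).
by rewrite addrK -{1}[Num.ceil x](subrK 1) expfzDr ?qvar_neq0// expr1z mulrC.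
Qed.

Lemma qint1 : qint 1 = 1.
Proof. by rewrite -[X in qint X]add0r qintS qint0 mulr0 add0r. Qed.

Lemma qfracV_identity (F : fieldType) (q a : F) :
  q != 0 -> a != 0 -> a + 1 != 0 ->
  1 - 1 / (q * - (q * (a + 1))^-1 + 1) = - a^-1.
Proof.
move=> q0 a0 a1; rewrite mulrN invfM mulVKf//.
have -> : - (a + 1)^-1 + 1 = a / (a + 1) by field.
by field; rewrite a0 a1.
Qed.

Lemma qfrac0 : qfrac 0 = 0.
Proof. by rewrite qfracE ceil0 subrr eqxx qint0. Qed.

Lemma qint_regular c : regular1 (qint c) c%:~R.
Proof.
elim: c => [|c ih|c ih].
- by rewrite qint0; have := regular1_poly 0; rewrite tofrac0 horner0.
- rewrite -addn1 PoszD qintS rmorphD; apply: (regular1D _ regular1_1).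
  by rewrite -[X in regular1 _ X]mul1r; apply: regular1M ih; exact: regular1_qvar.
- have -> : qint (- c.+1%:Z) = qvar^-1 * (qint (- c%:Z) + - 1).
    have -> : - c%:Z = - c.+1%:Z + 1 by rewrite -addn1 PoszD opprD addrNK.
    by rewrite qintS addrK mulKf// qvar_neq0.
  have -> : (- c.+1%:Z)%:~R = 1^-1 * ((- c%:Z)%:~R + - 1) :> rat.
    by rewrite invr1 mul1r -addn1 PoszD opprD rmorphD.
  apply: regular1M; first by apply: regular1V; [exact: regular1_qvar|].
  by apply: regular1D => //; apply/regular1N/regular1_1.
Qed.

Lemma qfrac_regular x : regular1 (qfrac x) x.
Proof.
have expr1 (c : int) : regular1 (qvar ^ c) 1.
  have nat1 (n : nat) : regular1 (qvar ^+ n) 1.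
    elim: n => [|n ih]; first by rewrite expr0; exact: regular1_1.
    by rewrite exprS -[X in regular1 _ X]mulr1; apply: regular1M regular1_qvar ih.
  case: c => n; first exact: nat1.
  by rewrite NegzE -exprnN -[X in regular1 _ X]invr1; apply: regular1V.
suff H n : forall b y, (0 < b <= n)%N -> int_mul_of b y -> regular1 (qfrac y) y.
  apply: (H `|denq x|%N `|denq x|%N); last exact: int_mul_of_denq.
  by rewrite leqnn denq_abs_gt0.
elim: n => [|n ih] b y /andP[b0 bn] bx; first by lia.
have [] := int_mul_of_ceil b0 bx; rewrite qfracE; set z := _ - y => z0 z1 zV.
have yE : y = (Num.ceil y)%:~R - z by rewrite /z opprB addrC subrK.
case: eqP => [ze|/eqP zn0].
  by rewrite [X in regular1 _ X]yE ze subr0; apply: qint_regular.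
have [p pb pz] := zV zn0.
rewrite [X in regular1 _ X]yE; apply: regular1D; first exact: qint_regular.
apply: regular1N; rewrite -[X in regular1 _ X]invrK -[X in regular1 _ X]mul1r.
apply: regular1M => //; apply: regular1V; rewrite ?invr_eq0//.
by apply: ih pz; lia.
Qed.

Lemma qfrac1 : qfrac 1 = 1.
Proof. by rewrite -[X in qfrac X]add0r qfracS qfrac0 mulr0 add0r. Qed.

Lemma qfracN1 : qfrac (- 1) = - qvar^-1.
Proof.
have := qfracS (- 1); rewrite addNr qfrac0 => /esym/eqP; rewrite addr_eq0.
move=> /eqP/(congr1 (fun y => qvar^-1 * y)).
by rewrite mulKf ?qvar_neq0// mulrN1.
Qed.

Lemma qfracV (x : rat) : x != 0 -> qfrac (- x^-1) = - (qvar * qfrac x)^-1.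
Proof.
have V (x' : rat) : - (- x'^-1)^-1 = x' :> rat by rewrite invrN invrK opprK.
have sym (x' : rat) : x' != 0 ->
    qfrac x' = - (qvar * qfrac (- x'^-1))^-1 ->
    qfrac (- x'^-1) = - (qvar * qfrac x')^-1.
  move=> x'0 ->; rewrite mulrN invrN opprK !invfM invrK.
  by rewrite mulKf ?invrK ?qvar_neq0.
have big (x' : rat) : 1 < x' -> qfrac (- x'^-1) = - (qvar * qfrac x')^-1.
  move=> x'1; have x'0 : 0 < x' by lra.
  have i1 : x'^-1 < 1 by rewrite invf_lt1.
  have i0 : 0 < x'^-1 by rewrite invr_gt0.
  rewrite qfracE; have -> : Num.ceil (- x'^-1) = 0.
    by apply/ceil_def; rewrite sub0r rmorphN/=; apply/andP; split; lra.
  rewrite sub0r opprK invr_eq0 gt_eqF// invrK qint0 !sub0r.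
  by rewrite invfM exprN1.
have neg n : forall x' : rat, x' < 0 -> - n%:R < x' ->
    qfrac (- x'^-1) = - (qvar * qfrac x')^-1.
  elim: n => [|n ih] x' x'0 x'n; first by exfalso; move: x'n; rewrite oppr0; lra.
  have [x'1|x'1|->] := ltgtP x' (- 1 : rat); last 1 first.
  - by rewrite invrN invr1 opprK qfrac1 qfracN1 mulrN mulfV ?qvar_neq0// invrN invr1 opprK.
  - have u0 : x' + 1 < 0 by lra.
    have un : - n%:R < x' + 1 by move: x'n; rewrite -natr1; lra.
    have x'n0 : x' != 0 by lra.
    have un0 : x' + 1 != 0 by lra.
    have i1 : - x'^-1 < 1 by rewrite -invrN invf_lt1; lra.
    have i0 : 0 < - x'^-1 by rewrite -invrN invr_gt0; lra.
    have c1 : Num.ceil (- x'^-1) = 1.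
      by apply/ceil_def; rewrite subrr/=; apply/andP; split; lra.
    have z0 : (1%:~R - - x'^-1 == 0) = false by apply/eqP; lra.
    have zE : (1%:~R - - x'^-1)^-1 = - (x' + 1)^-1 + 1 by field; rewrite un0 x'n0.
    have A0 := mulf_neq0 qvar_neq0 (regular1_neq0 (qfrac_regular x') x'n0).
    have := regular1_neq0 (qfrac_regular (x' + 1)) un0; rewrite qfracS => A1.
    rewrite qfracE c1 z0 zE subrr expr0z qint1 qfracS ih// qfracS.
    exact: qfracV_identity qvar_neq0 A0 A1.
  - by apply: sym; [lra|]; rewrite -[X in qfrac X = _]V big// -invrN invf_gt1; lra.
have negx (x' : rat) : x' < 0 -> qfrac (- x'^-1) = - (qvar * qfrac x')^-1.
  move=> x'0; apply: (neg (Num.truncn (- x')).+1) => //.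
  by have := truncnS_gt (- x'); lra.
move=> x0; have [xn|xp] := ltP x 0; first exact: negx.
apply: sym => //; rewrite -[X in qfrac X = _]V negx//.
by rewrite oppr_lt0 invr_gt0; lra.
Qed.

Theorem qrational_map_exists : exists Q, is_qrational_map Q.
Proof.
exists (fun x => if x is Some y then Some (qfrac y) else None); split.
- by rewrite qfrac0.
- by case=> //= x; rewrite mul1r qfracS.
case=> [x|] /=.
- rewrite addr0 mulf_eq0 (negPf qvar_neq0)/=; case: eqP => [->|/eqP x0].
    by rewrite qfrac0 eqxx.
  rewrite (negPf (regular1_neq0 (qfrac_regular x) x0)).
  by rewrite qfracV.
- by rewrite qfrac0.
Qed.

(* Main.v *)
Require Import Defs.
From mathcomp Require Import all_boot all_order all_algebra.
From mathcomp Require Import ring.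
From mathcomp Require Import all_classical all_reals all_analysis.
Import Order.TTheory GRing.Theory Num.Theory.
Import numFieldNormedType.Exports.

Set Implicit Arguments.
Unset Strict Implicit.
Unset Printing Implicit Defensive.

Local Open Scope ring_scope.

(* Differentiating the functional equations of [x]_q at q = 1 gives
   s(x + 1) = s(x) + x and s(-1/x) = (x + s(x)) / x^2 for the slope s(x) of
   [x]_q there. With s(0) = 0 they force
   s(a/b) = (x^2 - x + 1 - 1/b^2) / 2, x = a/b in lowest terms.
   Since dq/dh = 1 at h = 0, cr'/cr is the alternating sum of the divided
   differences (s(x_i) - s(x_j)) / (x_i - x_j): the part x^2 - x of s drops
   out, and what is left is a rational identity in the a_i and b_i. *)

(* f is regular at q = 1, with value v and derivative w there. *)
Definition jet1 (f : ratfun) (v w : rat) : Prop :=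
  exists n d : {poly rat},
    [/\ f = FracField.tofrac n / FracField.tofrac d, d.[1] != 0,
        v = n.[1] / d.[1]
      & w = (n^`().[1] * d.[1] - n.[1] * d^`().[1]) / d.[1] ^+ 2].

Lemma jet1_poly (p : {poly rat}) : jet1 (FracField.tofrac p) p.[1] p^`().[1].
Proof.
exists p, 1; rewrite tofrac1 derivC [(1 : {poly rat}).[1]]hornerC horner0 !divr1.
by split; rewrite ?mulr1 ?mulr0 ?subr0 ?expr1n ?divr1 ?oner_neq0.
Qed.

Lemma jet1_const1 : jet1 1 1 0.
Proof. by have := jet1_poly 1; rewrite tofrac1 derivC hornerC horner0. Qed.

Lemma jet1_qvar : jet1 qvar 1 1.
Proof. by have := jet1_poly 'X; rewrite derivX hornerX hornerC. Qed.

Lemma jet1D f g v w v' w' :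
  jet1 f v w -> jet1 g v' w' -> jet1 (f + g) (v + v') (w + w').
Proof.
move=> [n [d [-> d1 -> ->]]] [m [e [-> e1 -> ->]]].
exists (n * e + m * d), (d * e).
split; rewrite ?derivD ?derivM ?(hornerD, hornerM) ?mulf_neq0//.
- by rewrite tofracD !tofracM addf_div ?tofrac_neq0.
- by rewrite addf_div.
- by field; rewrite d1 e1.
Qed.

Lemma jet1M f g v w v' w' :
  jet1 f v w -> jet1 g v' w' -> jet1 (f * g) (v * v') (w * v' + v * w').
Proof.
move=> [n [d [-> d1 -> ->]]] [m [e [-> e1 -> ->]]].
exists (n * m), (d * e); split; rewrite ?derivM ?(hornerD, hornerM) ?mulf_neq0//.
- by rewrite !tofracM mulf_div.
- by rewrite mulf_div.
- by field; rewrite d1 e1.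
Qed.

Lemma jet1N f v w : jet1 f v w -> jet1 (- f) (- v) (- w).
Proof.
move=> [n [d [-> d1 -> ->]]]; exists (- n), d.
split; rewrite ?derivN ?hornerN ?tofracN ?mulNr//.
by field.
Qed.

Lemma jet1B f g v w v' w' :
  jet1 f v w -> jet1 g v' w' -> jet1 (f - g) (v - v') (w - w').
Proof. by move=> fj /jet1N; apply: jet1D. Qed.

Lemma jet1V f v w : v != 0 -> jet1 f v w -> jet1 f^-1 v^-1 (- (w / v ^+ 2)).
Proof.
move=> v0 [n [d [-> d1 vE ->]]]; move: v0; rewrite vE mulf_eq0 invr_eq0 negb_or.
by move=> /andP[n1 _]; exists d, n; rewrite !invf_div; split=> //; field; rewrite d1 n1.
Qed.

Lemma jet1_cross_ratio f1 f2 f3 f4 v1 v2 v3 v4 w1 w2 w3 w4 :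
    jet1 f1 v1 w1 -> jet1 f2 v2 w2 -> jet1 f3 v3 w3 -> jet1 f4 v4 w4 ->
    v1 != v3 -> v2 != v4 -> v1 != v4 -> v2 != v3 ->
  jet1 (cross_ratio f1 f2 f3 f4) (cross_ratio v1 v2 v3 v4)
    (cross_ratio v1 v2 v3 v4 *
       ((w1 - w3) / (v1 - v3) + (w2 - w4) / (v2 - v4)
        - (w1 - w4) / (v1 - v4) - (w2 - w3) / (v2 - v3))).
Proof.
move=> j1 j2 j3 j4.
rewrite -(subr_eq0 v1 v3) -(subr_eq0 v2 v4) -(subr_eq0 v1 v4) -(subr_eq0 v2 v3).
move=> n13 n24 n14 n23.
have den0 : (v1 - v4) * (v2 - v3) != 0 by rewrite mulf_neq0.
have := jet1M (jet1M (jet1B j1 j3) (jet1B j2 j4))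
  (jet1V den0 (jet1M (jet1B j1 j4) (jet1B j2 j3))).
congr jet1; rewrite /cross_ratio; field.
by rewrite n13 n24 n14 n23.
Qed.

Definition qrational_slope (x : rat) : rat :=
  (x ^+ 2 - x + 1 - ((denq x)%:~R ^+ 2)^-1) / 2.

Lemma denqD1 x : denq (x + 1) = denq x.
Proof.
have xE : x + 1 = (numq x + denq x)%:~R / (denq x)%:~R.
  by rewrite rmorphD/= mulrDl divff ?intr_eq0 ?denq_neq0// divq_num_den.
rewrite {1}xE coprimeq_den ?(negPf (denq_neq0 x)) ?normr_denq//.
have := coprime_num_den x; rewrite -!coprimezE /coprimez.
by rewrite gcdzC [gcdz (_ + _) _]gcdzC gcdzDr.
Qed.

Lemma sqr_denqV x : x != 0 -> denq (- x^-1) ^+ 2 = numq x ^+ 2.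
Proof.
move=> x0; rewrite denqN -{1}[x]divq_num_den invf_div coprimeq_den.
  by rewrite numq_eq0 (negPf x0) real_normK ?num_real.
by rewrite coprime_sym coprime_num_den.
Qed.

Lemma qrational_slope0 : qrational_slope 0 = 0.
Proof. by rewrite /qrational_slope (denq_int 0); field. Qed.

Lemma qrational_slopeD1 x : qrational_slope (x + 1) = qrational_slope x + x.
Proof. by rewrite /qrational_slope denqD1; field; rewrite intr_eq0 denq_neq0. Qed.

Lemma qrational_slopeV x : x != 0 ->
  qrational_slope (- x^-1) = (x + qrational_slope x) / x ^+ 2.
Proof.
move=> x0; rewrite /qrational_slope -rmorphXn/= sqr_denqV// rmorphXn/=.
have d0 : (denq x)%:~R != 0 :> rat by rewrite intr_eq0 denq_neq0.
rewrite numqE; field.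
by rewrite x0 d0.
Qed.

Lemma qrational_jet1 Q x : is_qrational_map Q ->
  jet1 (qrational Q x) x (qrational_slope x).
Proof.
move=> HQ; have fin y := qrational_map_finite y HQ; case: HQ => Q0 QT QS.
have qT y : qrational Q (y + 1) = qvar * qrational Q y + 1.
  by have := QT (Some y); rewrite /= mul1r !fin => -[].
elim/rat_modular_ind: x => [|x|x x0 jx].
- rewrite /qrational Q0 qrational_slope0.
  by have := jet1_poly 0; rewrite tofrac0 deriv0 horner0.
- rewrite qT qrational_slopeD1; split=> j.
    have := jet1D (jet1M jet1_qvar j) jet1_const1.
    by congr jet1; ring.
  have := jet1M (jet1V (oner_neq0 _) jet1_qvar) (jet1B j jet1_const1).
  rewrite addrK mulKf ?qvar_neq0//.
  by congr jet1; field.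
- have := QS (Some x); rewrite /= (negPf x0) !fin /= addr0.
  case: eqP => // _ [->]; rewrite qrational_slopeV//.
  have qx0 : 1 * x != 0 by rewrite mul1r.
  have := jet1N (jet1V qx0 (jet1M jet1_qvar jx)).
  by congr jet1; field.
Qed.

Lemma is_derive_ratfun_exp (R : realType) f v w : jet1 f v w ->
  is_derive (0 : R) (1 : R) (fun h => ratfun_eval f (expR h)) (ratr w).
Proof.
move=> [n [d [-> d1 _ ->]]].
pose N : {poly R} := map_poly ratr n; pose D : {poly R} := map_poly ratr d.
have e1 : expR (0 : R) = ratr 1 by rewrite expR0 rmorph1.
have D0 : D.[expR 0] != 0 by rewrite e1 horner_map fmorph_eq0.
have dN : is_derive (0 : R) 1 (horner N \o expR) (N^`().[expR 0] * expR 0).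
  exact: is_derive1_comp.
have dD : is_derive (0 : R) 1 (horner D \o expR) (D^`().[expR 0] * expR 0).
  exact: is_derive1_comp.
apply: (@near_eq_is_derive _ _ _
  ((horner N \o expR) * (fun h => ((horner D \o expR) h)^-1))).
  have cD : {for (0 : R), continuous (horner D \o expR)}.
    apply: differentiable_continuous; apply/derivable1_diffP.
    exact: (@ex_derive _ _ _ _ _ _ _ dD).
  have Dn : \forall h \near (0 : R), (horner D \o expR) h != 0.
    exact: cvgr_neq0 _ cD D0.
  by apply: filterS Dn => h Dh; rewrite ratfun_evalE//.
have dV := @is_deriveV R (horner D \o expR) 0 _ 1 D0 dD.
apply: is_derive_eq; rewrite /= /GRing.scale /=.
rewrite e1 !deriv_map !horner_map /=.
rewrite fmorph_div rmorphXn rmorphB !rmorphM rmorph1 /=; field.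
by rewrite fmorph_eq0.
Qed.


Lemma cross_ratio_plucker_identity (F : numFieldType)
    (a1 a2 a3 a4 b1 b2 b3 b4 : F) :
  let x a b := a / b in
  let s a b := ((a / b) ^+ 2 - a / b + 1 - (b ^+ 2)^-1) / 2 in
  let D a b c d := a * d - c * b in
  b1 != 0 -> b2 != 0 -> b3 != 0 -> b4 != 0 ->
  D a1 b1 a3 b3 != 0 -> D a1 b1 a4 b4 != 0 ->
  D a2 b2 a3 b3 != 0 -> D a2 b2 a4 b4 != 0 -> D a3 b3 a4 b4 != 0 ->
  (s a1 b1 - s a3 b3) / (x a1 b1 - x a3 b3)
  + (s a2 b2 - s a4 b4) / (x a2 b2 - x a4 b4)
  - (s a1 b1 - s a4 b4) / (x a1 b1 - x a4 b4)
  - (s a2 b2 - s a3 b3) / (x a2 b2 - x a3 b3) =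
  1 / (2 * D a3 b3 a4 b4) *
    (((D a1 b1 a4 b4 - D a1 b1 a3 b3) ^+ 2 - D a3 b3 a4 b4 ^+ 2)
       / (D a1 b1 a3 b3 * D a1 b1 a4 b4) -
     ((D a2 b2 a4 b4 - D a2 b2 a3 b3) ^+ 2 - D a3 b3 a4 b4 ^+ 2)
       / (D a2 b2 a3 b3 * D a2 b2 a4 b4)).
Proof.
move=> /= b10 b20 b30 b40 n13 n14 n23 n24 n34.
field.
by rewrite n13 n14 n23 n24 n34 b10 b20 b30 b40.
Qed.

Lemma plucker_neq0 (x y : rat) : x != y -> plucker x y != 0.
Proof.
apply: contraNneq => /eqP; rewrite subr_eq0 => /eqP e.
rewrite -[x]divq_num_den -[y]divq_num_den.
by rewrite eqr_div ?intr_eq0 ?denq_neq0// -!rmorphM e.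
Qed.

Theorem theorem1p5 (R : realType) (Q : option rat -> option ratfun)
    (x1 x2 x3 x4 : rat)
    (HQ : is_qrational_map Q) (Hx : uniq [:: x1; x2; x3; x4]) :
  let D13 : R := (plucker x1 x3)%:~R in
  let D14 : R := (plucker x1 x4)%:~R in
  let D23 : R := (plucker x2 x3)%:~R in
  let D24 : R := (plucker x2 x4)%:~R in
  let D34 : R := (plucker x3 x4)%:~R in
  derivable (@cross_ratio_exp R Q x1 x2 x3 x4) 0 1 /\
  cross_ratio' R Q x1 x2 x3 x4 / ratr (cross_ratio x1 x2 x3 x4) =
    1 / (2 * D34) *
    (((D14 - D13) ^+ 2 - D34 ^+ 2) / (D13 * D14) -
     ((D24 - D23) ^+ 2 - D34 ^+ 2) / (D23 * D24)).
Proof.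
move=> D13 D14 D23 D24 D34.
have [n13 n14 n23 n24 n34] :
    [/\ x1 != x3, x1 != x4, x2 != x3, x2 != x4 & x3 != x4].
  move: Hx; rewrite /= !inE !negb_or.
  by move=> /and4P[/and3P[_ -> ->] /andP[-> ->] -> _].
have j := jet1_cross_ratio (qrational_jet1 x1 HQ) (qrational_jet1 x2 HQ)
  (qrational_jet1 x3 HQ) (qrational_jet1 x4 HQ) n13 n24 n14 n23.
have dcr := is_derive_ratfun_exp R j.
split; first exact: (@ex_derive _ _ _ _ _ _ _ dcr).
rewrite /cross_ratio' derive1E (@derive_val _ _ _ _ _ _ _ dcr) -fmorph_div.
have cr0 : cross_ratio x1 x2 x3 x4 != 0.
  by rewrite /cross_ratio !(mulf_neq0, invr_neq0) ?subr_eq0.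
rewrite [_ / cross_ratio _ _ _ _]mulrC mulKf//.
have b0 (x : rat) : (denq x)%:~R != 0 :> rat by rewrite intr_eq0 denq_neq0.
have pE (x y : rat) : (plucker x y)%:~R =
    (numq x)%:~R * (denq y)%:~R - (numq y)%:~R * (denq x)%:~R :> rat.
  by rewrite rmorphB !rmorphM.
have p0 (x y : rat) : x != y ->
    (numq x)%:~R * (denq y)%:~R - (numq y)%:~R * (denq x)%:~R != 0 :> rat.
  by move=> xy; rewrite -pE intr_eq0 plucker_neq0.
have := cross_ratio_plucker_identity (b0 x1) (b0 x2) (b0 x3) (b0 x4)
  (p0 _ _ n13) (p0 _ _ n14) (p0 _ _ n23) (p0 _ _ n24) (p0 _ _ n34).
rewrite !divq_num_den -!pE -/(qrational_slope x1) -/(qrational_slope x2).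
rewrite -/(qrational_slope x3) -/(qrational_slope x4) => ->.
rewrite /D13 /D14 /D23 /D24 /D34.
move: (plucker x1 x3) (plucker x1 x4) (plucker x2 x3) (plucker x2 x4).
move: (plucker x3 x4) => p34 p13 p14 p23 p24.
rewrite !(rmorphM, rmorphB, rmorphXn, fmorphV, rmorph1) /=.
by rewrite !ratr_int rmorph_nat.
Qed.
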